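(* Let $n$ be a positive integer. The function $d_h\colon\mathbb{R}^n\times\mathbb{R}^n\to\mathbb{R}$ given by $d_h(x,y)=\cosh^{-1}([x][y]-\langle x,y\rangle)$ is a metric on $\mathbb{R}^n$ equivalent to the Euclidean metric $d_e$.
   Context: $\langle x,y\rangle$ is the standard inner product on $\mathbb{R}^n$, $\|x\|=\sqrt{\langle x,x\rangle}$, $[x]=\sqrt{1+\|x\|^2}$, and $\cosh^{-1}(t)=\log(t+\sqrt{t^2-1})$ for $t\ge1$. (One always has $[x][y]-\langle x,y\rangle\ge1$.) $d_e(x,y)=\|x-y\|$. Two metrics are equivalent if they induce the same topology (the same convergent sequences with the same limits). *)

(* Defs.v *)
From mathcomp Require Import all_boot all_order all_algebra.
From mathcomp Require Import all_classical all_reals all_analysis.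

Set Implicit Arguments.
Unset Strict Implicit.
Unset Printing Implicit Defensive.

Import Order.TTheory GRing.Theory Num.Theory.

Local Open Scope classical_set_scope.
Local Open Scope ring_scope.

Definition dotv (R : realType) (n : nat) (x y : 'rV[R]_n) : R :=
  \sum_(i < n) x 0 i * y 0 i.

(* The library norm on 'rV[R]_n is the sup norm, hence a separate definition. *)
Definition enorm (R : realType) (n : nat) (x : 'rV[R]_n) : R :=
  Num.sqrt (dotv x x).

Definition brack (R : realType) (n : nat) (x : 'rV[R]_n) : R :=
  Num.sqrt (1 + enorm x ^+ 2).

(* Meaningful for 1 <= t only; Num.sqrt and ln take default values elsewhere. *)
Definition arcosh (R : realType) (t : R) : R := ln (t + Num.sqrt (t ^+ 2 - 1)).

Definition d_e (R : realType) (n : nat) (x y : 'rV[R]_n) : R := enorm (x - y).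

Definition d_h (R : realType) (n : nat) (x y : 'rV[R]_n) : R :=
  arcosh (brack x * brack y - dotv x y).

(* The library's metricType bundles the distance with the carrier; a predicate
   is needed to say that a given function is a metric. *)
Definition is_metric (R : realType) (T : Type) (d : T -> T -> R) : Prop :=
  [/\ forall x y, 0 <= d x y,
      forall x y, d x y = 0 <-> x = y,
      forall x y, d x y = d y x
    & forall x y z, d x z <= d x y + d y z].

Definition mball (R : realType) (T : Type) (d : T -> T -> R) (x : T) (r : R)
  : set T := [set y | d x y < r].

Definition metric_topology (R : realType) (T : Type) (d : T -> T -> R)
  : set (set T) :=
  [set U | forall x, U x -> exists2 r : R, 0 < r & mball d x r `<=` U].

Definition equivalent_metrics (R : realType) (T : Type) (d1 d2 : T -> T -> R)
  : Prop := metric_topology d1 = metric_topology d2.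

(* Main.v *)
Require Import Defs.
From mathcomp Require Import all_boot all_order all_algebra.
From mathcomp Require Import all_classical all_reals all_analysis.
From mathcomp Require Import ring lra.

(** Write [X = ([x], x)] in the Lorentz space [R x R^n] with the form
    [L(X, Y) = X0 Y0 - <x, y>], so that [L(X, X) = 1] and [d_h] is [arcosh] of
    [t = L(X, Y)].  The form [- L] is positive definite on the orthogonal of
    [Y]; Cauchy-Schwarz for the components of [X] and [Z] orthogonal to [Y]
    gives [L(X, Z) <= t u + sqrt (t^2 - 1) sqrt (u^2 - 1)], with
    [u = L(Y, Z)], which is the triangle inequality by the addition formula for
    [cosh].  The same positivity applied to [Y - t X] gives
    [d_e x y <= [x] (exp (d_h x y) - 1)], while [2 (t - 1) <= d_e x y ^ 2] gives
    [d_h x y <= d_e x y + d_e x y ^ 2]; these two bounds give both separation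
    and the equality of the topologies. *)

Set Implicit Arguments.
Unset Strict Implicit.
Unset Printing Implicit Defensive.

Import Order.TTheory GRing.Theory Num.Theory.

Local Open Scope classical_set_scope.
Local Open Scope ring_scope.

(** At [(c, - b)] the form takes the value [c * (a * c - b ^+ 2)], which settles [0 < c]. *)
Lemma psd_discr (R : realType) (a b c : R) :
  (forall s t, 0 <= s ^+ 2 * a + 2 * (s * t) * b + t ^+ 2 * c) ->
  b ^+ 2 <= a * c.
Proof.
move=> psd.
have c_ge0 : 0 <= c by have := psd 0 1; lra.
have [c_gt0|c_le0] := ltP 0 c.
  have := psd c (- b).
  rewrite (_ : _ + _ = c * (a * c - b ^+ 2)); last by ring.
  by rewrite pmulr_rge0// subr_ge0.
have c0 : c = 0 by lra.
(* With [c = 0] the form at this point equals [- b ^+ 2], which forces [b = 0]. *)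
by have := psd b (- (a + 1) / 2); rewrite c0; nra.
Qed.

(** * Euclidean inner product and norm *)

Section Vectors.
Variables (R : realType) (n : nat).
Implicit Types x y z p : 'rV[R]_n.

Lemma dotvC x y : dotv x y = dotv y x.
Proof. by apply: eq_bigr => i _; rewrite mulrC. Qed.

Lemma dotvDl x y z : dotv (x + y) z = dotv x z + dotv y z.
Proof. by rewrite -big_split; apply: eq_bigr => i _; rewrite !mxE mulrDl. Qed.

Lemma dotvZl a x y : dotv (a *: x) y = a * dotv x y.
Proof. by rewrite /dotv mulr_sumr; apply: eq_bigr => i _; rewrite !mxE mulrA. Qed.

Lemma dotvDr x y z : dotv x (y + z) = dotv x y + dotv x z.
Proof. by rewrite dotvC dotvDl !(dotvC x). Qed.

Lemma dotvZr a x y : dotv x (a *: y) = a * dotv x y.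
Proof. by rewrite dotvC dotvZl dotvC. Qed.

Definition dotvE := (dotvDl, dotvDr, dotvZl, dotvZr).

Lemma dotvv_ge0 x : 0 <= dotv x x.
Proof. by apply: sumr_ge0 => i _; rewrite -expr2 sqr_ge0. Qed.

Lemma dotv_CauchySchwarz x y : dotv x y ^+ 2 <= dotv x x * dotv y y.
Proof.
apply: psd_discr => s t; have := dotvv_ge0 (s *: x + t *: y).
by rewrite !dotvE (dotvC y x); nra.
Qed.

Lemma enorm_ge0 x : 0 <= enorm x.
Proof. exact: sqrtr_ge0. Qed.

Lemma sqr_enorm x : enorm x ^+ 2 = dotv x x.
Proof. by rewrite sqr_sqrtr// dotvv_ge0. Qed.

Lemma dotv_le_enorm x y : dotv x y <= enorm x * enorm y.
Proof.
have xy_ge0 : 0 <= enorm x * enorm y by rewrite mulr_ge0 ?enorm_ge0.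
rewrite (le_trans (ler_norm _))// -(ler_pXn2r (n := 2))// ?nnegrE//.
by rewrite real_normK ?num_real// exprMn !sqr_enorm dotv_CauchySchwarz.
Qed.

Lemma enormD x y : enorm (x + y) <= enorm x + enorm y.
Proof.
rewrite -(ler_pXn2r (n := 2))// ?nnegrE ?addr_ge0 ?enorm_ge0//.
rewrite sqr_enorm sqrrD !sqr_enorm !dotvE (dotvC y x).
by have := dotv_le_enorm x y; lra.
Qed.

Lemma enormZ a x : enorm (a *: x) = `|a| * enorm x.
Proof.
by rewrite /enorm !dotvE mulrA -expr2 sqrtrM ?sqr_ge0// sqrtr_sqr.
Qed.

Lemma enorm0_eq0 x : enorm x = 0 -> x = 0.
Proof.
move=> x0; have := sqr_enorm x; rewrite x0 expr0n => /esym/psumr_eq0P xx0.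
apply/rowP => i; rewrite mxE; apply/eqP; rewrite -sqrf_eq0 expr2.
by rewrite xx0// => j _; rewrite -expr2 sqr_ge0.
Qed.

Lemma enormB x y : enorm (x - y) = enorm (y - x).
Proof. by rewrite -opprB -scaleN1r enormZ normrN1 mul1r. Qed.

Lemma sqr_brack x : brack x ^+ 2 = 1 + dotv x x.
Proof. by rewrite sqr_sqrtr ?sqr_enorm// addr_ge0// dotvv_ge0. Qed.

Lemma brack_gt0 x : 0 < brack x.
Proof. by rewrite sqrtr_gt0 sqr_enorm ltr_pwDl// dotvv_ge0. Qed.

Lemma enorm_le_brack x : enorm x <= brack x.
Proof.
rewrite -(ler_pXn2r (n := 2))// ?nnegrE ?enorm_ge0// ?(ltW (brack_gt0 x))//.
by rewrite sqr_enorm sqr_brack; lra.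
Qed.

(** * The Lorentz form on the hyperboloid *)

Definition lor x y : R := brack x * brack y - dotv x y.

Lemma lorC x y : lor x y = lor y x.
Proof. by rewrite /lor mulrC dotvC. Qed.

Lemma lorxx x : lor x x = 1.
Proof. by rewrite /lor -expr2 sqr_brack; ring. Qed.

(* The hypothesis says that [(p0, p)] is Lorentz-orthogonal to [([y], y)]. *)
Lemma orth_spacelike p (p0 : R) y : p0 * brack y = dotv p y ->
  dotv p p <= (dotv p p - p0 ^+ 2) * brack y ^+ 2.
Proof.
move=> py; rewrite mulrBl -exprMn py sqr_brack.
by have := dotv_CauchySchwarz p y; lra.
Qed.

Lemma orth_ge0 p (p0 : R) y : p0 * brack y = dotv p y ->
  0 <= dotv p p - p0 ^+ 2.
Proof.
move=> /orth_spacelike /(le_trans (dotvv_ge0 p)).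
by rewrite pmulr_lge0// exprn_gt0// brack_gt0.
Qed.

(** Cauchy-Schwarz for [- L] on [X - L(X, Y) Y] and [Z - L(Y, Z) Y]: the factors on the right are
    their squared lengths, and the squared term is their product. *)
Lemma lor_discr x y z :
  (lor x y * lor y z - lor x z) ^+ 2
    <= (lor x y ^+ 2 - 1) * (lor y z ^+ 2 - 1).
Proof.
apply: psd_discr => s t.
(* Since [L(Y, Y) = 1], this [k] makes [s X + t Z - k Y] orthogonal to [Y]. *)
pose k := s * lor x y + t * lor y z.
have yy := sqr_brack y.
have orth : (s * brack x + t * brack z - k * brack y) * brack y
    = dotv (s *: x + t *: z + (- k) *: y) y.
  rewrite !dotvE mulrBl -[k * _ * _]mulrA -expr2 yy /k /lor (dotvC z y).
  by ring.
have := orth_ge0 orth; rewrite !dotvE (dotvC y x) (dotvC z y) (dotvC z x).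
have -> : dotv x x = brack x ^+ 2 - 1 by rewrite sqr_brack; ring.
have -> : dotv y y = brack y ^+ 2 - 1 by rewrite sqr_brack; ring.
have -> : dotv z z = brack z ^+ 2 - 1 by rewrite sqr_brack; ring.
have -> : dotv x y = brack x * brack y - lor x y by rewrite /lor; ring.
have -> : dotv y z = brack y * brack z - lor y z by rewrite /lor; ring.
have -> : dotv x z = brack x * brack z - lor x z by rewrite /lor; ring.
by congr (0 <= _); rewrite /k; ring.
Qed.

(** Positivity of [- L] on [X - L(X, Y) Y], orthogonal to [Y], gives [L(X, Y) ^ 2 >= 1];
    Cauchy-Schwarz in [R^n] excludes the negative sign. *)
Lemma lor_ge1 x y : 1 <= lor x y.
Proof.
have lor_ge0 : 0 <= lor x y.
  rewrite subr_ge0 (le_trans (dotv_le_enorm x y))//.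
  by rewrite ler_pM ?enorm_ge0 ?enorm_le_brack.
have xy2 : 0 <= dotv (x + (- lor x y) *: y) (x + (- lor x y) *: y)
    - (brack x - lor x y * brack y) ^+ 2.
  apply: (@orth_ge0 _ _ y); rewrite !dotvE mulrBl -mulrA -expr2 sqr_brack.
  by rewrite /lor; ring.
suff : 0 <= lor x y ^+ 2 - 1 by nra.
move: xy2; rewrite !dotvE (dotvC y x).
have -> : dotv x x = brack x ^+ 2 - 1 by rewrite sqr_brack; ring.
have -> : dotv y y = brack y ^+ 2 - 1 by rewrite sqr_brack; ring.
have -> : dotv x y = brack x * brack y - lor x y by rewrite /lor; ring.
by congr (0 <= _); ring.
Qed.

End Vectors.

(** * Estimates for the inverse hyperbolic cosine *)

Section Arcosh.
Variable R : realType.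
Implicit Types t u w : R.

Lemma expR_arcosh t : 1 <= t -> expR (arcosh t) = t + Num.sqrt (t ^+ 2 - 1).
Proof.
move=> t1; rewrite lnK// posrE ltr_wpDr ?sqrtr_ge0//; exact: lt_le_trans t1.
Qed.

Lemma sqrB1_ge0 t : 1 <= t -> 0 <= t ^+ 2 - 1.
Proof. by move=> t1; rewrite subr_ge0 expr_ge1// (le_trans _ t1). Qed.

Lemma sqrt_sqrB1 t : 1 <= t -> Num.sqrt (t ^+ 2 - 1) ^+ 2 = t ^+ 2 - 1.
Proof. by move=> t1; rewrite sqr_sqrtr// sqrB1_ge0. Qed.

Lemma arcosh_ge0 t : 1 <= t -> 0 <= arcosh t.
Proof. by move=> t1; rewrite ln_ge0// ler_wpDr ?sqrtr_ge0. Qed.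

Lemma arcosh1 : arcosh (1 : R) = 0.
Proof. by rewrite /arcosh expr1n subrr sqrtr0 addr0 ln1. Qed.

Lemma arcosh_le_add t u w : 1 <= t -> 1 <= u -> 1 <= w ->
  w <= t * u + Num.sqrt (t ^+ 2 - 1) * Num.sqrt (u ^+ 2 - 1) ->
  arcosh w <= arcosh t + arcosh u.
Proof.
move=> t1 u1 w1 wle; rewrite -ler_expR expRD !expR_arcosh//.
move: wle (sqrt_sqrB1 t1) (sqrt_sqrB1 u1).
move: (sqrtr_ge0 (t ^+ 2 - 1)) (sqrtr_ge0 (u ^+ 2 - 1)).
set S := Num.sqrt (t ^+ 2 - 1); set S' := Num.sqrt (u ^+ 2 - 1).
move=> S0 S'0 wle SE S'E.
(* [(t + S) * (u + S')] splits into [t * u + S * S'], the cosh of the sum, which bounds [w], and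
   [t * S' + u * S], its sinh, which has to bound the square root. *)
have sum0 : 0 <= t * S' + u * S by nra.
suff : Num.sqrt (w ^+ 2 - 1) <= t * S' + u * S by nra.
rewrite -[leRHS]ger0_norm// -sqrtr_sqr ler_wsqrtr//.
have -> : (t * S' + u * S) ^+ 2 = (t * u + S * S') ^+ 2 - 1.
  have -> : (t * S' + u * S) ^+ 2 =
    t ^+ 2 * S' ^+ 2 + u ^+ 2 * S ^+ 2 + 2 * t * u * S * S' by ring.
  have -> : (t * u + S * S') ^+ 2 =
    t ^+ 2 * u ^+ 2 + S ^+ 2 * S' ^+ 2 + 2 * t * u * S * S' by ring.
  by rewrite S'E SE; ring.
by rewrite lerD2r ler_pXn2r// nnegrE; lra.
Qed.

(** Here [t <= 1 + e ^+ 2 / 2] and the square root is at most [e ^+ 2 / 2 + e], so their sum is at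
    most [1 + (e + e ^+ 2)], hence at most [expR (e + e ^+ 2)]. *)
Lemma arcosh_le t e : 1 <= t -> 0 <= e -> 2 * (t - 1) <= e ^+ 2 ->
  arcosh t <= e + e ^+ 2.
Proof.
move=> t1 e0 te.
have S_le : Num.sqrt (t ^+ 2 - 1) <= e ^+ 2 / 2 + e.
  have s0 : 0 <= e ^+ 2 / 2 + e by have := sqr_ge0 e; lra.
  by rewrite -[leRHS]ger0_norm// -sqrtr_sqr ler_wsqrtr//; nra.
rewrite -ler_expR expR_arcosh//.
by apply: le_trans (expR_ge1Dx _); lra.
Qed.

End Arcosh.

(** * The metric axioms and the comparison with [d_e] *)

Section Hyperbolic.
Variables (R : realType) (n : nat).
Implicit Types x y z : 'rV[R]_n.

Lemma d_h_triangle x y z : d_h x z <= d_h x y + d_h y z.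
Proof.
apply: arcosh_le_add; rewrite -?/(lor _ _) ?lor_ge1//.
rewrite -sqrtrM ?sqrB1_ge0 ?lor_ge1//.
rewrite -lerBlDl (le_trans (ler_norm _))// -sqrtr_sqr ler_wsqrtr//.
by rewrite -sqrrN opprB lor_discr.
Qed.

Lemma d_h_le x y : d_h x y <= d_e x y + d_e x y ^+ 2.
Proof.
apply: arcosh_le; rewrite -?/(lor _ _) ?lor_ge1 ?enorm_ge0//.
rewrite /d_e sqr_enorm -(scaleN1r y) !dotvE (dotvC y x) /lor.
have := sqr_brack x; have := sqr_brack y.
(* [d_e x y ^+ 2] equals [2 * (lor x y - 1) + (brack x - brack y) ^+ 2]. *)
by have := sqr_ge0 (brack x - brack y); nra.
Qed.

(** Split [y - x] as [(y - t x) + (t - 1) x]. The first part has norm at most [sqrt (t^2 - 1) [x]],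
    the second at most [(t - 1) [x]], and [t + sqrt (t^2 - 1)] is [exp (d_h x y)]. *)
Lemma d_e_le x y : d_e x y <= brack x * (expR (d_h x y) - 1).
Proof.
set t := lor x y.
have t1 : 1 <= t := lor_ge1 x y.
have yx : enorm (y + (- t) *: x) <= Num.sqrt (t ^+ 2 - 1) * brack x.
  have b0 := ltW (brack_gt0 x).
  rewrite -[leRHS]ger0_norm ?mulr_ge0 ?sqrtr_ge0// -sqrtr_sqr ler_wsqrtr//.
  rewrite exprMn sqrt_sqrB1//.
  have orth : (brack y - t * brack x) * brack x = dotv (y + (- t) *: x) x.
    rewrite !dotvE mulrBl -mulrA -expr2 sqr_brack (dotvC y x) /t /lor.
    by ring.
  rewrite (le_trans (orth_spacelike orth))//.
  rewrite ler_wpM2r ?sqr_ge0// !dotvE (dotvC y x).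
  have -> : dotv x x = brack x ^+ 2 - 1 by rewrite sqr_brack; ring.
  have -> : dotv y y = brack y ^+ 2 - 1 by rewrite sqr_brack; ring.
  have -> : dotv x y = brack x * brack y - t by rewrite /t /lor; ring.
  by rewrite le_eqVlt; apply/orP; left; apply/eqP; ring.
rewrite expR_arcosh// -/(lor x y) -/t /d_e enormB.
have -> : y - x = (y + (- t) *: x) + (t - 1) *: x.
  by rewrite scalerBl scale1r scaleNr addrA subrK.
rewrite (le_trans (enormD _ _))// enormZ ger0_norm ?subr_ge0//.
have : (t - 1) * enorm x <= (t - 1) * brack x.
  by rewrite ler_wpM2l ?subr_ge0// enorm_le_brack.
lra.
Qed.

Lemma d_h_is_metric : is_metric (@d_h R n).
Proof.
split=> [x y|x y|x y|x y z]; last exact: d_h_triangle.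
- exact/arcosh_ge0/lor_ge1.
- split=> [xy0|->]; last by rewrite /d_h -/(lor y y) lorxx arcosh1.
  apply/eqP; rewrite -subr_eq0; apply/eqP/enorm0_eq0/eqP.
  rewrite eq_le enorm_ge0 andbT.
  by have := d_e_le x y; rewrite xy0 expR0 subrr mulr0.
- by rewrite /d_h -!/(lor _ _) lorC.
Qed.

End Hyperbolic.

Lemma metric_topology_sub (R : realType) (T : Type) (d1 d2 : T -> T -> R) :
  (forall x (r : R), 0 < r ->
    exists2 s : R, 0 < s & mball d2 x s `<=` mball d1 x r) ->
  metric_topology d1 `<=` metric_topology d2.
Proof.
move=> finer U oU x /oU[r r0 rU]; have [s s0 sr] := finer x r r0.
by exists s => //; apply: subset_trans rU.
Qed.

Theorem theorem2p7 (R : realType) (n : nat) (n_gt0 : (0 < n)%N) :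
  is_metric (@d_h R n) /\ equivalent_metrics (@d_h R n) (@d_e R n).
Proof.
split; first exact: d_h_is_metric.
apply/seteqP; split; apply: metric_topology_sub => x r r0.
(* For [e < 1] and [e < r / 2], [e + e ^+ 2 <= 2 * e < r]. *)
- exists (Num.min 1 (r / 2)); first by rewrite lt_min ltr01 divr_gt0.
  move=> y; rewrite /mball/= lt_min => /andP[e1 er].
  apply: le_lt_trans (d_h_le x y) _.
  have : 0 <= d_e x y := enorm_ge0 _.
  nra.
- have b0 := brack_gt0 x.
  have q0 : 0 < r / brack x by rewrite divr_gt0.
  (* This radius solves [brack x * (expR s - 1) = r] for [s]; it depends on the centre [x]. *)
  exists (ln (1 + r / brack x)); first by rewrite ln_gt0// ltrDl.
  move=> y; rewrite /mball/= -ltr_expR lnK ?posrE ?addr_gt0// => dr.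
  apply: le_lt_trans (d_e_le x y) _.
  by rewrite mulrC -ltr_pdivlMr// ltrBlDl.
Qed.
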